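(* Let $R$ be a (commutative, unital) reduced $f$-ring with bounded inversion, and let $R^*$ be its bounded part. Then: (1) $R$ is a $PW$-ring if and only if $R^*$ is a $PW$-ring. (2) $R$ is a $UPW$-ring if and only if $R^*$ is a $UPW$-ring.
   Context: An $f$-ring is a lattice-ordered ring $A$ such that $c(a\vee b)=(ca)\vee(cb)$ for all $a,b\in A$ and $c\ge 0$; it has bounded inversion if every element $\geq 1$ is invertible. The absolute value is $|a|=a\vee(-a)$, and the bounded part of $R$ is the subring $R^*=\{a\in R: |a|\le n\cdot 1 \text{ for some } n\in\mathbb{N}\}$. A commutative ring $S$ with unity is a $PW$-ring (resp. $UPW$-ring) if for all $a,b\in S$ with $aS\cap bS=0$ the ideal $\mathrm{Ann}_S(a)+\mathrm{Ann}_S(b)$ contains a regular element, i.e. a non-zero-divisor (resp. a unit), where $\mathrm{Ann}_S(a)=\{s\in S: sa=0\}$. *)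

(* Defs.v *)
From HB Require Import structures.
From mathcomp Require Import all_boot all_order ssralg orderedzmod.
From mathcomp Require Import boolp classical_sets.
(* Not [all_algebra]: once [Num.NumDomain] is imported, Hierarchy Builder
   requires every join with it to be declared, and [LatticeRing] below would be
   rejected.  Importing [all_algebra] after this file is harmless. *)
Set Implicit Arguments.
Unset Strict Implicit.
Unset Printing Implicit Defensive.
Import Order.TTheory GRing.Theory.
Local Open Scope ring_scope.

(* All rings below may be the zero ring ("Pz" structures). *)

HB.mixin Record isLatticeOrderedRing R
    of GRing.PzRing R & Order.Lattice ring_display R := {
  ler_wD2r : forall z x y : R, x <= y -> x + z <= y + z;
  mulr_nneg : forall x y : R, 0 <= x -> 0 <= y -> 0 <= x * y
}.

#[short(type="latticeRingType")]
HB.structure Definition LatticeRing :=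
  { R of isLatticeOrderedRing R & GRing.PzRing R
       & Order.Lattice ring_display R }.

(* The multiplication is commutative, hence the one-sided axiom. *)
HB.mixin Record LatticeRing_isFRing R
    of LatticeRing R & GRing.ComPzRing R := {
  mulr_joinr : forall c a b : R,
    0 <= c -> c * Order.join a b = Order.join (c * a) (c * b)
}.

#[short(type="comFRingType")]
HB.structure Definition ComFRing :=
  { R of LatticeRing_isFRing R & LatticeRing R & GRing.ComPzRing R }.

(* [GRing.unit] is not available here: it requires a decidable unit predicate
   and a nontrivial ring. *)
Definition invertible (S : comPzRingType) (x : S) : Prop :=
  exists y : S, x * y = 1.

Definition reduced (S : comPzRingType) : Prop :=
  forall (x : S) (n : nat), x ^+ n = 0 -> x = 0.

Definition bounded_inversion (R : comFRingType) : Prop :=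
  forall x : R, 1 <= x -> invertible x.

Section PW.
Local Open Scope classical_set_scope.

Definition principal (S : comPzRingType) (a : S) : set S :=
  [set a * s | s in [set: S]].

Definition Ann (S : comPzRingType) (a : S) : set S := [set s | s * a = 0].

Definition ideal_sum (S : comPzRingType) (I J : set S) : set S :=
  [set x + y | x in I & y in J].

(* [GRing.lreg r] is injectivity of multiplication by [r], i.e. [r] is a
   non-zero-divisor. *)
Definition PW_ring (S : comPzRingType) : Prop :=
  forall a b : S, principal a `&` principal b = [set 0] ->
    exists2 r : S, ideal_sum (Ann a) (Ann b) r & GRing.lreg r.

Definition UPW_ring (S : comPzRingType) : Prop :=
  forall a b : S, principal a `&` principal b = [set 0] ->
    exists2 u : S, ideal_sum (Ann a) (Ann b) u & invertible u.

End PW.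

Definition absv (R : latticeRingType) (a : R) : R := Order.join a (- a).

Definition bounded (R : comFRingType) : {pred R} :=
  fun a => `[< exists n : nat, absv a <= n%:R >].

Section BoundedSubring.
Variable R : comFRingType.
Implicit Types a b c x y z t : R.

Lemma fring_lerD x y z t : x <= y -> z <= t -> x + z <= y + t.
Proof.
move=> xy zt; apply: (le_trans (ler_wD2r _ _ _ xy)).
by rewrite ![y + _]addrC; exact: ler_wD2r.
Qed.

Lemma fring_subr_ge0 x y : (0 <= y - x) = (x <= y).
Proof.
apply/idP/idP => [/(ler_wD2r x)|/(ler_wD2r (- x))].
  by rewrite add0r subrK.
by rewrite subrr.
Qed.

Lemma fring_lerN2 x y : (- x <= - y) = (y <= x).
Proof. by rewrite -[LHS]fring_subr_ge0 opprK addrC fring_subr_ge0. Qed.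

Lemma fring_leNr x y : (x <= - y) = (y <= - x).
Proof. by rewrite -[LHS]fring_lerN2 opprK. Qed.

Lemma fring_joinD_le x y z t : x + z <= t -> y + z <= t -> Order.join x y + z <= t.
Proof.
move=> /(ler_wD2r (- z)) + /(ler_wD2r (- z)).
rewrite !addrK => xt yt.
have /(ler_wD2r z) : Order.join x y <= t - z by rewrite leUx xt.
by rewrite subrK.
Qed.

Lemma fring_double_le0 x : x + x <= 0 -> x <= 0.
Proof.
move=> x2; have j0 := leUr 0 x; have jx := leUl x 0.
set j := Order.join x 0 in j0 jx.
suff jj : j + j <= j.
  by apply: (le_trans jx); have := ler_wD2r (- j) _ _ jj; rewrite addrK subrr.
apply: fring_joinD_le; last by rewrite add0r.
rewrite addrC; apply: fring_joinD_le; last by rewrite add0r.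
exact: (le_trans x2).
Qed.

Lemma fring_double_ge0 x : 0 <= x + x -> 0 <= x.
Proof.
move=> x2; rewrite -[x]opprK fring_leNr oppr0.
by apply: fring_double_le0; rewrite -opprD -oppr0 fring_lerN2.
Qed.

Lemma absv_le x y : (absv x <= y) = (x <= y) && (- y <= x).
Proof. by rewrite /absv leUx -[- x <= y]fring_lerN2 opprK. Qed.

Lemma absv_ge0 x : 0 <= absv x.
Proof.
apply: fring_double_ge0; rewrite -(subrr x).
by apply: fring_lerD; [exact: leUl | exact: leUr].
Qed.

Lemma fring_ler01 : 0 <= 1 :> R.
Proof.
set p : R := Order.join 1 0; have p0 : 0 <= p by exact: leUr.
have : absv 1 * p = p.
  rewrite mulrC [absv 1]/absv mulr_joinr // mulrN !mulr1.
  by apply/join_idPl/(@le_trans _ _ 0) => //; rewrite -oppr0 fring_lerN2.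
rewrite mulr_joinr ?absv_ge0 // mulr1 mulr0.
rewrite (join_idPl (absv_ge0 1)) => absp.
have pp : p + p <= absv 1 + 1.
  apply: fring_joinD_le; rewrite addrC; apply: fring_joinD_le.
  - by apply: ler_wD2r; exact: leUl.
  - by apply: ler_wD2r; exact: absv_ge0.
  - by rewrite addrC; apply: ler_wD2r; exact: absv_ge0.
  - by rewrite addr0 -(addNr 1); apply: ler_wD2r; exact: leUr.
apply: (le_trans p0); move: pp.
by move=> /(ler_wD2r (- p)); rewrite absp addrK [p + 1]addrC addrK.
Qed.

Lemma fring_ler0n n : 0 <= n%:R :> R.
Proof.
elim: n => // n n0; rewrite -natr1 -[0](addr0 0).
by apply: fring_lerD => //; exact: fring_ler01.
Qed.

Lemma fring_mulr_le x y c d :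
  absv x <= c -> absv y <= d -> x * y <= c * d.
Proof.
rewrite !absv_le => /andP[xc cx] /andP[yd dy].
have h1 : 0 <= (c - x) * (d + y).
  apply: mulr_nneg; first by rewrite fring_subr_ge0.
  by rewrite addrC -[d]opprK fring_subr_ge0.
have h2 : 0 <= (c + x) * (d - y).
  apply: mulr_nneg; last by rewrite fring_subr_ge0.
  by rewrite addrC -[c]opprK fring_subr_ge0.
rewrite -fring_subr_ge0; apply: fring_double_ge0.
have := fring_lerD h1 h2; rewrite addr0; congr (_ <= _).
rewrite mulrBl mulrDl !mulrDr !mulrN !opprD addrACA.
rewrite [RHS]addrACA [x * d - _]addrC [c * d + _ + _]addrACA.
rewrite subrr addr0; congr (_ + _).
by rewrite [- (x * d) - _]addrC -addrA [- (x * d) + _]addrCA addNr addr0.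
Qed.

Lemma absvN x : absv (- x) = absv x.
Proof. by rewrite /absv opprK joinC. Qed.

Lemma boundedP x : reflect (exists n : nat, absv x <= n%:R) (x \in @bounded R).
Proof. exact: asboolP. Qed.

Lemma bounded_subring_closed : subring_closed (@bounded R).
Proof.
split.
- apply/boundedP; exists 1%N; rewrite absv_le lexx -fring_subr_ge0 opprK.
  exact: (fring_ler0n 2).
- move=> x y /boundedP[n xn] /boundedP[m ym]; apply/boundedP.
  move: xn ym; rewrite -(absvN y) !absv_le => /andP[xn nx] /andP[ym my].
  exists (n + m)%N; rewrite absv_le natrD opprD.
  by rewrite !fring_lerD.
- move=> x y /boundedP[n xn] /boundedP[m ym]; apply/boundedP.
  exists (n * m)%N; rewrite absv_le natrM fring_mulr_le //=.
  by rewrite -fring_lerN2 opprK -mulNr fring_mulr_le // absvN.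
Qed.

HB.instance Definition _ :=
  GRing.isSubringClosed.Build R (@bounded R) bounded_subring_closed.

End BoundedSubring.

Record bounded_part (R : comFRingType) := BoundedPart {
  bounded_val :> R;
  bounded_valP : bounded_val \in @bounded R
}.

HB.instance Definition _ (R : comFRingType) :=
  [isSub for @bounded_val R].
HB.instance Definition _ (R : comFRingType) :=
  [Choice of bounded_part R by <:].
HB.instance Definition _ (R : comFRingType) :=
  GRing.SubChoice_isSubComPzRing.Build R (@bounded R) (bounded_part R)
    (bounded_subring_closed R).

(* Main.v *)
(* In a reduced ring [aS] and [bS] meet trivially iff [a b = 0], so both
   properties say when [Ann a + Ann b] contains a regular element or a unit for
   [a b = 0].  Squares of an f-ring are nonnegative, so [w = (1 + a^2)^-1] exists
   and both [w] and [a w] are bounded: every element of [R] is a quotient of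
   bounded ones by a unit of [R], which transfers annihilators and regular
   elements between [R] and its bounded part.  The remaining point is that units
   of [R] need not be units of the bounded part.  If [s + t = 1] in [R] then
   [2 (s^2 + t^2) = 1 + (s - t)^2] is invertible, and replacing [s], [t] by
   [s^2 / (s^2 + t^2)], [t^2 / (s^2 + t^2)] gives a bounded decomposition
   of [1] with at least the same annihilated elements. *)
Require Import Defs.
From mathcomp Require Import all_boot all_order ssralg orderedzmod.
From mathcomp Require Import classical_sets.
From mathcomp Require Import ring.
Import Order.TTheory GRing.Theory.
Local Open Scope ring_scope.

Section ReducedRing.
Variables (S : comPzRingType) (S_reduced : reduced S).

Lemma principal_meet0P (a b : S) :
  (principal a `&` principal b = [set 0])%classic <-> a * b = 0.
Proof.
split=> [ab0|ab0].
  suff : (principal a `&` principal b)%classic (a * b) by rewrite ab0.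
  by split; [exists b|exists a => //; rewrite mulrC].
apply/seteqP; split=> [x [[s _ <-] [t _ bt]]|x ->] /=.
  apply: (S_reduced _ 2); rewrite expr2 -{2}bt.
  by rewrite mulrACA ab0 mul0r.
by split; exists 0; rewrite ?mulr0.
Qed.

Lemma ideal_sum_AnnP (P : S -> Prop) :
  (forall a b : S, (principal a `&` principal b = [set 0])%classic ->
     exists2 r, ideal_sum (Ann a) (Ann b) r & P r) <->
  (forall a b : S, a * b = 0 ->
     exists s t, [/\ s * a = 0, t * b = 0 & P (s + t)]).
Proof.
split=> PS a b /principal_meet0P/PS.
  by move=> [_ [s sa [t tb <-]] Pst]; exists s, t.
by move=> [s [t [sa tb Pst]]]; exists (s + t) => //; exists s => //; exists t.
Qed.

End ReducedRing.

Lemma invertible_lreg (S : comPzRingType) (x : S) : invertible x -> GRing.lreg x.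
Proof.
move=> [y xy] u v /(congr1 ( *%R y)).
by rewrite !mulrA [y * x]mulrC xy !mul1r.
Qed.

Section FRing.
Variable R : comFRingType.
Implicit Types w x y : R.

Lemma fring_addr_ge0 x y : 0 <= x -> 0 <= y -> 0 <= x + y.
Proof. by move=> x0 y0; rewrite -[0]addr0 fring_lerD. Qed.

(* Positive and negative parts [p], [n] of [x] satisfy [p n <= c p] and
   [p n <= c n] for [c = 1 + p + n], whence [p n <= c (p /\ n) = 0]. *)
Lemma fring_sqr_ge0 x : 0 <= x * x.
Proof.
set p := Order.join x 0; pose n := p - x.
have p0 : 0 <= p by exact: leUr.
have n0 : 0 <= n by rewrite fring_subr_ge0 leUl.
pose c : R := 1 + p + n.
have c0 : 0 <= c.
  by apply: fring_addr_ge0 => //; rewrite fring_addr_ge0 // fring_ler01.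
have pn_le0 : p * n <= 0.
  rewrite -fring_subr_ge0 sub0r.
  have cp : c * p = Order.join (c * x) 0 by rewrite mulr_joinr // mulr0.
  have : c * p <= c * p - p * n.
    rewrite [X in X <= _]cp leUx; apply/andP; split.
      rewrite -fring_subr_ge0.
      have -> : c * p - p * n - c * x = n + n * n by rewrite /c /n; ring.
      by rewrite fring_addr_ge0 // mulr_nneg.
    have -> : c * p - p * n = p + p * p by rewrite /c; ring.
    by rewrite fring_addr_ge0 // mulr_nneg.
  by rewrite -fring_subr_ge0 addrAC subrr add0r.
have pn : p * n = 0 by apply/le_anti; rewrite pn_le0 mulr_nneg.
have -> : x * x = p * p + n * n - (p * n) *+ 2 by rewrite /n; ring.
by rewrite pn mul0rn subr0 fring_addr_ge0 // mulr_nneg.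
Qed.

Lemma fring_inv_ge0 x y : 0 <= x -> x * y = 1 -> 0 <= y.
Proof.
move=> x0 xy.
have -> : y = x * (y * y) by rewrite mulrA xy mul1r.
by rewrite mulr_nneg // fring_sqr_ge0.
Qed.

Lemma bounded_frac x y w :
  0 <= y -> y * w = 1 -> absv x <= y -> x * w \in @bounded R.
Proof.
move=> y0 yw; rewrite absv_le => /andP[xy yx].
have w0 := fring_inv_ge0 _ _ y0 yw.
apply/boundedP; exists 1%N; rewrite absv_le -yw -mulNr.
apply/andP; split; rewrite -fring_subr_ge0 -mulrBl mulr_nneg //.
  by rewrite fring_subr_ge0.
by rewrite fring_subr_ge0.
Qed.

Lemma absv_id x : 0 <= x -> absv x = x.
Proof.
by move=> x0; apply/join_idPl/(le_trans _ x0); rewrite -oppr0 fring_lerN2.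
Qed.

Lemma absv_le1Dsqr x : absv x <= 1 + x * x.
Proof.
have sq y : 0 <= 1 + y * y by rewrite fring_addr_ge0 ?fring_ler01 ?fring_sqr_ge0.
have le y : y <= 1 + y * y.
  rewrite -fring_subr_ge0; apply: fring_double_ge0.
  have -> : 1 + y * y - y + (1 + y * y - y) = (1 + y * y) + (1 - y) * (1 - y).
    by ring.
  by rewrite fring_addr_ge0 // fring_sqr_ge0.
by rewrite absv_le le -fring_lerN2 opprK -mulrNN le.
Qed.

End FRing.

Lemma bounded_valD (R : comFRingType) (x y : bounded_part R) :
  bounded_val (x + y) = bounded_val x + bounded_val y.
Proof. exact: (rmorphD (\val : bounded_part R -> R)). Qed.

Lemma bounded_valM (R : comFRingType) (x y : bounded_part R) :
  bounded_val (x * y) = bounded_val x * bounded_val y.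
Proof. exact: (rmorphM (\val : bounded_part R -> R)). Qed.

Section BoundedInversion.
Variables (R : comFRingType) (R_bi : bounded_inversion R).
Implicit Types a b s t x : R.

Lemma invertible_1D x : 0 <= x -> invertible (1 + x).
Proof. by move=> x0; apply: R_bi; rewrite -{1}[1]addr0 fring_lerD. Qed.

Lemma bounded_denominator x :
  exists w y : bounded_part R,
    invertible (bounded_val w) /\ x * bounded_val w = bounded_val y.
Proof.
have sq0 := fring_sqr_ge0 _ x.
have [w xw] := invertible_1D _ sq0.
have d0 : 0 <= 1 + x * x by rewrite fring_addr_ge0 // fring_ler01.
have wB : w \in @bounded R.
  rewrite -[w]mul1r; apply: (bounded_frac _ _ _ _ d0 xw).
  by rewrite absv_id ?fring_ler01 // -{1}[1]addr0 fring_lerD.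
have xwB : x * w \in @bounded R.
  by apply: (bounded_frac _ _ _ _ d0 xw); exact: absv_le1Dsqr.
exists (BoundedPart wB), (BoundedPart xwB); split => //=.
by exists (1 + x * x); rewrite mulrC.
Qed.

Lemma lreg_bounded_part (r : bounded_part R) :
  GRing.lreg (bounded_val r) <-> GRing.lreg r.
Proof.
split=> [rr x y rxy|rr x y rxy].
  by apply/val_inj/rr; rewrite -!bounded_valM rxy.
have [w [z [wi zE]]] := bounded_denominator (x - y).
have /rr z0 : r * z = r * 0.
  apply/val_inj; rewrite mulr0 rmorphM rmorph0 /= -zE mulrA mulrBr rxy.
  by rewrite subrr mul0r.
apply/eqP; rewrite -subr_eq0; apply/eqP/(invertible_lreg _ _ wi).
by rewrite mulr0 mulrC zE z0.
Qed.

Lemma invertible_bounded_val (r : bounded_part R) :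
  invertible r -> invertible (bounded_val r).
Proof.
move=> [y ry]; exists (bounded_val y).
by rewrite -bounded_valM ry.
Qed.

Lemma Ann_sum_of_bounded (P : R -> Prop) (Q : bounded_part R -> Prop) :
    (forall r, Q r -> P (bounded_val r)) ->
    (forall a b : bounded_part R, a * b = 0 ->
       exists s t : bounded_part R,
         [/\ s * a = 0, t * b = 0 & Q (s + t)]) ->
  forall a b, a * b = 0 -> exists s t, [/\ s * a = 0, t * b = 0 & P (s + t)].
Proof.
move=> QP QB a b ab0.
have [w [a' [wi a'E]]] := bounded_denominator a.
have [v [b' [vi b'E]]] := bounded_denominator b.
have [|s [t [sa tb /QP]]] := QB a' b'.
  by apply/val_inj; rewrite rmorphM rmorph0 /= -a'E -b'E mulrACA ab0 mul0r.
rewrite bounded_valD => Pst; exists (bounded_val s), (bounded_val t); split=> //.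
  apply: (invertible_lreg _ _ wi); rewrite mulr0 mulrC -mulrA a'E.
  by rewrite -bounded_valM sa.
apply: (invertible_lreg _ _ vi); rewrite mulr0 mulrC -mulrA b'E.
by rewrite -bounded_valM tb.
Qed.

Lemma lreg_Ann_sum_bounded (a b : bounded_part R) s t :
    s * bounded_val a = 0 -> t * bounded_val b = 0 -> GRing.lreg (s + t) ->
  exists s' t' : bounded_part R,
    [/\ s' * a = 0, t' * b = 0 & GRing.lreg (s' + t')].
Proof.
move=> sa tb st.
have [w [s' [wi s'E]]] := bounded_denominator s.
have [v [t' [vi t'E]]] := bounded_denominator t.
exists (s' * v), (t' * w); split.
- apply/val_inj; rewrite !rmorphM rmorph0 /= -s'E.
  by rewrite mulrC !mulrA [_ * s]mulrC sa !mul0r.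
- apply/val_inj; rewrite !rmorphM rmorph0 /= -t'E.
  by rewrite mulrC !mulrA [_ * t]mulrC tb !mul0r.
apply/lreg_bounded_part; rewrite bounded_valD !bounded_valM -s'E -t'E.
rewrite [t * _ * _]mulrAC -mulrDl -mulrDl.
by do !apply: GRing.lregM => //; exact: invertible_lreg.
Qed.

Lemma invertible_Ann_sum_bounded (a b : bounded_part R) s t :
    s * bounded_val a = 0 -> t * bounded_val b = 0 -> invertible (s + t) ->
  exists s' t' : bounded_part R,
    [/\ s' * a = 0, t' * b = 0 & invertible (s' + t')].
Proof.
move=> sa tb [u stu].
pose p := s * u; pose q := t * u.
have pq : p + q = 1 by rewrite -mulrDl.
have p0 := fring_sqr_ge0 _ p; have q0 := fring_sqr_ge0 _ q.
have [v dv] := invertible_1D _ (fring_sqr_ge0 _ (p - q)).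
set d := 1 + _ in dv.
have dE : d = (p * p) *+ 2 + (q * q) *+ 2.
  by rewrite /d -[X in X + _](mulr1 1) -pq; ring.
have p20 : 0 <= (p * p) *+ 2 by rewrite mulr2n fring_addr_ge0.
have q20 : 0 <= (q * q) *+ 2 by rewrite mulr2n fring_addr_ge0.
have d0 : 0 <= d by rewrite dE fring_addr_ge0.
have pB : (p * p) *+ 2 * v \in @bounded R.
  apply: (bounded_frac _ _ _ _ d0 dv).
  by rewrite absv_id // dE -{1}[_ *+ 2]addr0 fring_lerD.
have qB : (q * q) *+ 2 * v \in @bounded R.
  apply: (bounded_frac _ _ _ _ d0 dv).
  by rewrite absv_id // dE -{1}[_ *+ 2]add0r fring_lerD.
exists (BoundedPart pB), (BoundedPart qB); split.
- apply/val_inj; rewrite rmorphM rmorph0 /=.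
  have -> : (p * p) *+ 2 * v * bounded_val a =
            s * bounded_val a * (u * p * v *+ 2) by rewrite /p; ring.
  by rewrite sa mul0r.
- apply/val_inj; rewrite rmorphM rmorph0 /=.
  have -> : (q * q) *+ 2 * v * bounded_val b =
            t * bounded_val b * (u * q * v *+ 2) by rewrite /q; ring.
  by rewrite tb mul0r.
exists 1; apply/val_inj; rewrite mulr1 rmorphD rmorph1 /=.
by rewrite -mulrDl -dE.
Qed.

Lemma Ann_sum_to_bounded (P : R -> Prop) (Q : bounded_part R -> Prop) :
    (forall (a b : bounded_part R) s t,
       s * bounded_val a = 0 -> t * bounded_val b = 0 -> P (s + t) ->
       exists s' t' : bounded_part R,
         [/\ s' * a = 0, t' * b = 0 & Q (s' + t')]) ->
    (forall a b, a * b = 0 ->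
       exists s t, [/\ s * a = 0, t * b = 0 & P (s + t)]) ->
  forall a b : bounded_part R, a * b = 0 ->
    exists s t : bounded_part R, [/\ s * a = 0, t * b = 0 & Q (s + t)].
Proof.
move=> PQ PR a b /(congr1 (\val : bounded_part R -> R)).
by rewrite rmorphM rmorph0 => /PR[s [t []]]; exact: PQ.
Qed.

End BoundedInversion.

Lemma bounded_part_reduced (R : comFRingType) :
  reduced R -> reduced (bounded_part R).
Proof.
move=> R_reduced x n xn; apply/val_inj; rewrite rmorph0.
by apply: (R_reduced _ n); rewrite -rmorphXn xn rmorph0.
Qed.

Theorem proposition4p12 (R : comFRingType)
    (R_reduced : reduced R) (R_bi : bounded_inversion R) :
  (PW_ring R <-> PW_ring (bounded_part R)) /\
  (UPW_ring R <-> UPW_ring (bounded_part R)).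
Proof.
have B_reduced := bounded_part_reduced _ R_reduced.
split; split=> /ideal_sum_AnnP-/(_ ltac:(done)) H; apply/ideal_sum_AnnP => //.
- exact: Ann_sum_to_bounded (lreg_Ann_sum_bounded _ R_bi) H.
- by apply: Ann_sum_of_bounded H => // r /lreg_bounded_part; apply.
- exact: Ann_sum_to_bounded (invertible_Ann_sum_bounded _ R_bi) H.
- by apply: Ann_sum_of_bounded H => //; exact: invertible_bounded_val.
Qed.
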